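(* Assume that the equation $-\nabla(f_n\Delta y_n)+q_ny_n=\lambda w_ny_n$, $1\le n\le N$, is in $\Omega_N^{\mathbb{R},+}$ (and fixed). Then, in each of the coordinate systems $\mathcal{O}_{1,3}^{\mathbb{C}}$, $\mathcal{O}_{1,4}^{\mathbb{C}}$, $\mathcal{O}_{2,3}^{\mathbb{C}}$, and $\mathcal{O}_{2,4}^{\mathbb{C}}$ in $\mathcal{B}^{\mathbb{C}}$, every continuous eigenvalue branch is always increasing (not necessarily strictly) in the two real axis directions (that is, in the directions of $a_{12}$ and $b_{22}$ in $\mathcal{O}_{1,3}^{\mathbb{C}}$; of $a_{12}$ and $b_{21}$ in $\mathcal{O}_{1,4}^{\mathbb{C}}$; of $a_{11}$ and $b_{22}$ in $\mathcal{O}_{2,3}^{\mathbb{C}}$; of $a_{11}$ and $b_{21}$ in $\mathcal{O}_{2,4}^{\mathbb{C}}$).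
   Context: $N\ge2$ is an integer, $\Delta y_n=y_{n+1}-y_n$, $\nabla y_n=y_n-y_{n-1}$. The equation is in $\Omega_N^{\mathbb{R},+}$ if $f_0,\dots,f_N$ are real and nonzero, $q_1,\dots,q_N$ are real, and $w_1,\dots,w_N>0$. A boundary condition is $A\begin{pmatrix}y_0\\ f_0\Delta y_0\end{pmatrix}+B\begin{pmatrix}y_N\\ f_N\Delta y_N\end{pmatrix}=0$ with $A,B$ complex $2\times2$ matrices, $\mathrm{rank}(A,B)=2$; it is denoted $[A\,|\,B]$, where $(A,B)$ and $(TA,TB)$, $T\in GL(2,\mathbb{C})$, are identified (quotient topology). $\mathcal{B}^{\mathbb{C}}$ is the space of self-adjoint boundary conditions, i.e. those with $AEA^*=BEB^*$, $E=\begin{pmatrix}0&1\\-1&0\end{pmatrix}$. It is covered by the relatively open coordinate systems (two real coordinates and $z\in\mathbb{C}$) $$\mathcal{O}_{1,3}^{\mathbb{C}}=\left\{\left[\begin{array}{cccc}1&a_{12}&0&\bar z\\0&z&-1&b_{22}\end{array}\right]\right\},\quad \mathcal{O}_{1,4}^{\mathbb{C}}=\left\{\left[\begin{array}{cccc}1&a_{12}&\bar z&0\\0&z&b_{21}&1\end{array}\right]\right\},$$ $$\mathcal{O}_{2,3}^{\mathbb{C}}=\left\{\left[\begin{array}{cccc}a_{11}&-1&0&\bar z\\ z&0&-1&b_{22}\end{array}\right]\right\},\quad \mathcal{O}_{2,4}^{\mathbb{C}}=\left\{\left[\begin{array}{cccc}a_{11}&-1&\bar z&0\\ z&0&b_{21}&1\end{array}\right]\right\}.$$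 A number $\lambda$ is an eigenvalue for a boundary condition if there is a nonzero complex sequence $y=\{y_n\}_{n=0}^{N+1}$ satisfying both the equation and the boundary condition; for self-adjoint problems eigenvalues are real, with multiplicity (dimension of the solution space, which equals the order as a zero of the characteristic polynomial) $1$ or $2$. A continuous eigenvalue branch over $\mathcal{B}^{\mathbb{C}}$ is a continuous function $\Lambda$ from a connected open subset of $\mathcal{B}^{\mathbb{C}}$ to $\mathbb{R}$ whose value at each $\mathbf{B}$ in the domain is an eigenvalue for $\mathbf{B}$, and which near each $\mathbf{A}$ in its domain coincides with one of the following: if $\Lambda(\mathbf{A})$ is simple, the locally unique continuous function through $\Lambda(\mathbf{A})$ whose values are simple eigenvalues; if $\Lambda(\mathbf{A})$ has multiplicity $2$, one of the two functions $\Lambda_1\le\Lambda_2$ giving the exactly two eigenvalues (counting multiplicity) near $\Lambda(\mathbf{A})$ of boundary conditions near $\mathbf{A}$. Monotonicity in a coordinate direction refers to the restriction of $\Lambda$ to intervals of that coordinate, the other coordinates being fixed, along which the boundary condition lies in the domain of $\Lambda$; ``increasing'' means non-decreasing. *)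

(* Defs.v *)
From HB Require Import structures.
From mathcomp Require Import all_boot all_order all_algebra complex.
From mathcomp Require Import all_classical all_reals all_analysis.
From mathcomp Require Import ring.

Set Implicit Arguments.
Unset Strict Implicit.
Unset Printing Implicit Defensive.

Import Order.TTheory GRing.Theory Num.Theory.
Import numFieldNormedType.Exports.

Local Open Scope classical_set_scope.
Local Open Scope complex_scope.
Local Open Scope ring_scope.
Local Open Scope quotient_scope.

(* The topology of the complex numbers given by the modulus; the libraries
   declare it only on the alias R[i]^o. *)
HB.instance Definition _ (R : realType) :=
  PseudoPointedMetric.copy R[i] R[i]^o.

Section DifferenceEquation.
Variable R : realType.
Implicit Types (u : nat -> R[i]) (f q w : nat -> R).

Definition fwd_diff u (n : nat) : R[i] := u n.+1 - u n.
Definition bwd_diff u (n : nat) : R[i] := u n - u n.-1.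

(* Only f_0, ..., f_N, q_1, ..., q_N and w_1, ..., w_N matter; being real is
   enforced by the types. *)
Definition Omega_Rplus (N : nat) f w : Prop :=
  (forall n, (n <= N)%N -> f n != 0) /\
  (forall n, (1 <= n <= N)%N -> 0 < w n).

(* A row vector in dimension N + 2 seen as the sequence y_0, ..., y_{N+1};
   the value at indices n > N + 1 is never used. *)
Definition term (N : nat) (y : 'rV[R[i]]_N.+2) (n : nat) : R[i] :=
  y ord0 (inord n).

Definition solves_equation (N : nat) f q w (lam : R[i])
    (y : 'rV[R[i]]_N.+2) : Prop :=
  forall n, (1 <= n <= N)%N ->
    - bwd_diff (fun k => (f k)%:C * fwd_diff (term y) k) n + (q n)%:C * term y n
    = lam * (w n)%:C * term y n.

Definition boundary_vector (N : nat) f (y : 'rV[R[i]]_N.+2) (k : nat) :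
    'cV[R[i]]_2 :=
  \col_(i < 2) (if i == ord0 then term y k
                else (f k)%:C * fwd_diff (term y) k).

(* M : 'M_(2, 2 + 2) is the block matrix (A, B). *)
Definition satisfies_bc (N : nat) f (M : 'M[R[i]]_(2, 2 + 2))
    (y : 'rV[R[i]]_N.+2) : Prop :=
  lsubmx M *m boundary_vector f y 0 + rsubmx M *m boundary_vector f y N = 0.

End DifferenceEquation.

Section BoundaryConditions.
Variable R : realType.

Definition rank2_mx : set 'M[R[i]]_(2, 2 + 2) := [set M | \rank M = 2%N].

Definition bc_eqv (M M' : rank2_mx) : bool :=
  `[< exists2 T : 'M[R[i]]_2, T \in unitmx & val M' = T *m val M >].

Lemma bc_eqv_refl : reflexive bc_eqv.
Proof. by move=> M; apply/asboolP; exists 1%:M; rewrite ?unitmx1// mul1mx. Qed.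

Lemma bc_eqv_sym : symmetric bc_eqv.
Proof.
have H M M' : bc_eqv M M' -> bc_eqv M' M.
  move=> /asboolP[T Tu E]; apply/asboolP; exists (invmx T).
    by rewrite unitmx_inv.
  by rewrite E mulKmx.
by move=> M M'; apply/idP/idP; apply: H.
Qed.

Lemma bc_eqv_trans : transitive bc_eqv.
Proof.
move=> M2 M1 M3 /asboolP[T Tu E] /asboolP[S Su F]; apply/asboolP.
by exists (S *m T); rewrite ?unitmx_mul ?Su// F E mulmxA.
Qed.

Canonical bc_equiv := EquivRel bc_eqv bc_eqv_refl bc_eqv_sym bc_eqv_trans.

(* All boundary conditions [A | B], with the quotient topology. *)
Definition bc_space : topologicalType :=
  quotient_topology {eq_quot bc_equiv}.

Definition bc_class (M : rank2_mx) : bc_space :=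
  \pi_(quotient_topology {eq_quot bc_equiv}) M.

Definition symplectic_mx : 'M[R[i]]_2 :=
  \matrix_(i, j) (if (i == 0) && (j == 1) then 1
                  else if (i == 1) && (j == 0) then -1 else 0).

Definition conj_transpose (A : 'M[R[i]]_2) : 'M[R[i]]_2 :=
  (map_mx (fun z => z^*) A)^T.

Definition self_adjoint_mx (M : 'M[R[i]]_(2, 2 + 2)) : Prop :=
  lsubmx M *m symplectic_mx *m conj_transpose (lsubmx M) =
  rsubmx M *m symplectic_mx *m conj_transpose (rsubmx M).

Definition self_adjoint_set : set bc_space :=
  [set bc_class M | M in [set M : rank2_mx | self_adjoint_mx (val M)]].

(* The self-adjoint boundary conditions, with the subspace topology. *)
Definition BC : topologicalType := set_type self_adjoint_set.

Definition bc_mx (B : BC) : 'M[R[i]]_(2, 2 + 2) :=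
  val (repr (set_val B : quotient_topology {eq_quot bc_equiv})).

Definition mk_BC (M : 'M[R[i]]_(2, 2 + 2)) (rkM : rank2_mx M)
    (saM : self_adjoint_mx M) : BC :=
  SigSub (mem_set (ex_intro2 _ _ (SigSub (mem_set rkM) : rank2_mx) saM erefl
    : self_adjoint_set (bc_class (SigSub (mem_set rkM))))).

(* bc_mx is a representative: properties of matrices that are invariant under
   M |-> T *m M may be read off it. *)
Lemma bc_mx_mk_BC (M : 'M[R[i]]_(2, 2 + 2)) (rkM : rank2_mx M)
    (saM : self_adjoint_mx M) :
  exists2 T : 'M[R[i]]_2, T \in unitmx & bc_mx (mk_BC rkM saM) = T *m M.
Proof.
rewrite /bc_mx /= set_valE /= /bc_class.
set x : rank2_mx := SigSub _.
have : bc_eqv x (repr (\pi_(quotient_topology {eq_quot bc_equiv}) x)).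
  have /eqP : \pi_(quotient_topology {eq_quot bc_equiv}) x =
         \pi_(quotient_topology {eq_quot bc_equiv})
           (repr (\pi_(quotient_topology {eq_quot bc_equiv}) x)).
    by rewrite reprK.
  by move/eqP/eqmodP.
by move=> /asboolP.
Qed.

Lemma satisfies_bcM (N : nat) (f : nat -> R) (M : 'M[R[i]]_(2, 2 + 2))
    (T : 'M[R[i]]_2) (y : 'rV[R[i]]_N.+2) :
  T \in unitmx -> satisfies_bc f (T *m M) y <-> satisfies_bc f M y.
Proof.
move=> Tu; rewrite /satisfies_bc.
rewrite -[M in T *m M]hsubmxK mul_mx_row row_mxKl row_mxKr -!mulmxA -mulmxDr.
split=> [E|->]; last by rewrite mulmx0.
by rewrite -(mulKmx Tu (_ + _)) E mulmx0.
Qed.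

Definition mx_of_rows (r1 r2 : seq R[i]) : 'M[R[i]]_(2, 2 + 2) :=
  \matrix_(i, j) nth 0 (if i == ord0 then r1 else r2) j.

Definition mx13 (a12 b22 : R) (z : R[i]) : 'M[R[i]]_(2, 2 + 2) :=
  mx_of_rows [:: 1; a12%:C; 0;   z^*  ]
             [:: 0; z;      - 1; b22%:C].
Definition mx14 (a12 b21 : R) (z : R[i]) : 'M[R[i]]_(2, 2 + 2) :=
  mx_of_rows [:: 1; a12%:C; z^*;    0]
             [:: 0; z;      b21%:C; 1].
Definition mx23 (a11 b22 : R) (z : R[i]) : 'M[R[i]]_(2, 2 + 2) :=
  mx_of_rows [:: a11%:C; - 1; 0;   z^*   ]
             [:: z;      0;   - 1; b22%:C].
Definition mx24 (a11 b21 : R) (z : R[i]) : 'M[R[i]]_(2, 2 + 2) :=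
  mx_of_rows [:: a11%:C; - 1; z^*;    0]
             [:: z;      0;   b21%:C; 1].

Lemma conj_real_complex (x : R) : (x%:C)^* = x%:C.
Proof. by apply/CrealP/complex_realP; exists x. Qed.

Lemma mx_of_rows_rank2 (r1 r2 : seq R[i]) (k l : nat) :
  (k < 4)%N -> (l < 4)%N -> r2`_k = 0 -> r1`_l = 0 ->
  r1`_k != 0 -> r2`_l != 0 -> rank2_mx (mx_of_rows r1 r2).
Proof.
move=> k4 l4 z2 z1 n1 n2; apply/eqP; apply/row_freeP.
exists (\matrix_(i < 2 + 2, j < 2)
  (if (i == k :> nat) && (j == 0 :> nat) then (r1`_k)^-1
   else if (i == l :> nat) && (j == 1 :> nat) then (r2`_l)^-1 else 0)).
apply/matrixP => i j; rewrite !mxE.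
case: j => -[|[|//]] j2 /=.
- rewrite (bigD1 (Ordinal k4)) //= big1 ?addr0; last first.
    move=> [m m4] /eqP mk; rewrite !mxE /= andbT andbF.
    by case: (m =P k) => [E|_]; rewrite ?mulr0//; case: mk; apply/val_inj.
  rewrite !mxE /= eqxx /=.
  by case: i => -[|[|//]] i2 /=; rewrite ?z2 ?mul0r ?mulfV// eqE /= eqxx.
- rewrite (bigD1 (Ordinal l4)) //= big1 ?addr0; last first.
    move=> [m m4] /eqP mk; rewrite !mxE /= andbT andbF.
    by case: (m =P l) => [E|_]; rewrite ?mulr0//; case: mk; apply/val_inj.
  rewrite !mxE /= eqxx andbF /=.
  by case: i => -[|[|//]] i2 /=; rewrite ?z1 ?mul0r ?mulfV// eqE /= eqxx.
Qed.

Lemma mx13_rank2 a12 b22 z : rank2_mx (mx13 a12 b22 z).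
Proof.
by apply: (@mx_of_rows_rank2 _ _ 0 2); rewrite //= ?oppr_eq0 oner_eq0.
Qed.

Lemma mx14_rank2 a12 b21 z : rank2_mx (mx14 a12 b21 z).
Proof.
by apply: (@mx_of_rows_rank2 _ _ 0 3); rewrite //= ?oppr_eq0 oner_eq0.
Qed.

Lemma mx23_rank2 a11 b22 z : rank2_mx (mx23 a11 b22 z).
Proof.
by apply: (@mx_of_rows_rank2 _ _ 1 2); rewrite //= ?oppr_eq0 oner_eq0.
Qed.

Lemma mx24_rank2 a11 b21 z : rank2_mx (mx24 a11 b21 z).
Proof.
by apply: (@mx_of_rows_rank2 _ _ 1 3); rewrite //= ?oppr_eq0 oner_eq0.
Qed.

Lemma mx13_self_adjoint a12 b22 z : self_adjoint_mx (mx13 a12 b22 z).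
Proof.
apply/matrixP => i j; rewrite !(mxE, big_ord_recl, big_ord0) /=.
case: i => -[|[|//]] i2; case: j => -[|[|//]] j2 /=;
rewrite ?(rmorphN, rmorph1, rmorph0, conj_real_complex, conjCK) /=; ring.
Qed.

Lemma mx14_self_adjoint a12 b21 z : self_adjoint_mx (mx14 a12 b21 z).
Proof.
apply/matrixP => i j; rewrite !(mxE, big_ord_recl, big_ord0) /=.
case: i => -[|[|//]] i2; case: j => -[|[|//]] j2 /=;
rewrite ?(rmorphN, rmorph1, rmorph0, conj_real_complex, conjCK) /=; ring.
Qed.

Lemma mx23_self_adjoint a11 b22 z : self_adjoint_mx (mx23 a11 b22 z).
Proof.
apply/matrixP => i j; rewrite !(mxE, big_ord_recl, big_ord0) /=.
case: i => -[|[|//]] i2; case: j => -[|[|//]] j2 /=;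
rewrite ?(rmorphN, rmorph1, rmorph0, conj_real_complex, conjCK) /=; ring.
Qed.

Lemma mx24_self_adjoint a11 b21 z : self_adjoint_mx (mx24 a11 b21 z).
Proof.
apply/matrixP => i j; rewrite !(mxE, big_ord_recl, big_ord0) /=.
case: i => -[|[|//]] i2; case: j => -[|[|//]] j2 /=;
rewrite ?(rmorphN, rmorph1, rmorph0, conj_real_complex, conjCK) /=; ring.
Qed.

Definition O13 (a12 b22 : R) (z : R[i]) : BC :=
  mk_BC (mx13_rank2 a12 b22 z) (mx13_self_adjoint a12 b22 z).
Definition O14 (a12 b21 : R) (z : R[i]) : BC :=
  mk_BC (mx14_rank2 a12 b21 z) (mx14_self_adjoint a12 b21 z).
Definition O23 (a11 b22 : R) (z : R[i]) : BC :=
  mk_BC (mx23_rank2 a11 b22 z) (mx23_self_adjoint a11 b22 z).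
Definition O24 (a11 b21 : R) (z : R[i]) : BC :=
  mk_BC (mx24_rank2 a11 b21 z) (mx24_self_adjoint a11 b21 z).

End BoundaryConditions.

Section Eigenvalues.
Variables (R : realType) (N : nat) (f q w : nat -> R).
Implicit Types (B : BC R) (l : R) (L : BC R -> R).

Definition eigen_sol B (lam : R[i]) (y : 'rV[R[i]]_N.+2) : Prop :=
  solves_equation f q w lam y /\ satisfies_bc f (bc_mx B) y.

Definition is_eigenvalue B (lam : R[i]) : Prop :=
  exists2 y : 'rV[R[i]]_N.+2, y != 0 & eigen_sol B lam y.

(* The solution space has dimension k; k = 0 means "not an eigenvalue". *)
Definition has_multiplicity B (lam : R[i]) (k : nat) : Prop :=
  exists2 V : {vspace 'rV[R[i]]_N.+2},
    (forall y, y \in V <-> eigen_sol B lam y) & \dim V = k.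

Definition simple_germ B l L : Prop :=
  [/\ L B = l,
      \forall B' \near B, {for B', continuous L} &
      \forall B' \near B, has_multiplicity B' (L B')%:C 1].

Definition the_simple_germ B l L : Prop :=
  simple_germ B l L /\
  forall L', simple_germ B l L' -> \forall B' \near B, L' B' = L B'.

(* For all B' near B, the eigenvalues of B' at distance less than e from l,
   counted with multiplicity, are exactly L1 B' <= L2 B'. *)
Definition double_germs B l (L1 L2 : BC R -> R) : Prop :=
  exists2 e : R, 0 < e & \forall B' \near B,
    [/\ L1 B' <= L2 B', `|L1 B' - l| < e, `|L2 B' - l| < e &
        forall m : R, `|m - l| < e ->
          has_multiplicity B' m%:C ((L1 B' == m) + (L2 B' == m))].

(* L is a total function, of which only the values on the domain D matter. *)
Definition continuous_eigenvalue_branch (D : set (BC R)) L : Prop :=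
  [/\ open D /\ connected D,
      {within D, continuous L},
      forall B, D B -> is_eigenvalue B (L B)%:C,
      forall B, D B -> has_multiplicity B (L B)%:C 1 ->
        exists2 L0, the_simple_germ B (L B) L0 &
          \forall B' \near B, L B' = L0 B' &
      forall B, D B -> has_multiplicity B (L B)%:C 2 ->
        exists L1 L2, double_germs B (L B) L1 L2 /\
          ((\forall B' \near B, L B' = L1 B') \/
           (\forall B' \near B, L B' = L2 B'))].

End Eigenvalues.

Definition increasing_along (R : realType) (D : set (BC R)) (L : BC R -> R)
    (p : R -> BC R) : Prop :=
  forall s t : R, s <= t -> (forall u, s <= u <= t -> D (p u)) ->
    L (p s) <= L (p t).

(* Main.v *)
Require Import Defs.
From HB Require Import structures.
From mathcomp Require Import all_boot all_order all_algebra complex.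
From mathcomp Require Import all_classical all_reals all_analysis.
From mathcomp Require Import ring.

(** Fix a boundary condition with coordinate a and another one with coordinate
    a', all other coordinates being equal. If y and v solve the equation for
    lam and mu and satisfy these two conditions, Green's identity reads

      (lam - mu) <y, v>_w = (a - a') l(y) conj(l(v)),

    where l(y) is one of the four boundary values y_0, f_0 Dy_0, y_N, f_N Dy_N.
    The lemmas lagrange_form_mx13, ..., lagrange_form_mx24 compute the right
    side in the four charts; the sign + there is what makes all eight real
    directions increasing.

    Along a path a |-> lam(a) of eigenvalues that is continuous at a, this
    gives (lam(u) - lam(a)) (u - a) >= 0 for all u near a (local_monotone).
    Otherwise there are u -> a where this product is negative; along an
    ultrafilter refining that filter, normalised eigenvectors v(u) converge to
    an eigenvector y at a, by compactness. Green's identity for y and v(u),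
    multiplied by u - a, is

      (lam(u) - lam(a)) (u - a) <y, v(u)>_w = (u - a)^2 l(y) conj(l(v(u))).

    Now <y, v(u)>_w tends to <y, y>_w > 0, so the left side eventually has
    negative real part, whereas l(y) conj(l(v(u))) is identically 0 or tends to
    |l(y)|^2 > 0, so the right side eventually has nonnegative real part.

    A function that is monotone around each point in this weak sense is
    monotone (locally_monotone_le), by a supremum argument, and a branch
    restricted to a coordinate line is continuous because the charts are
    continuous maps into the quotient space (mk_BC_continuous). *)

Set Implicit Arguments.
Unset Strict Implicit.
Unset Printing Implicit Defensive.

Import Order.TTheory GRing.Theory Num.Theory.
Import numFieldNormedType.Exports.

Local Open Scope classical_set_scope.
Local Open Scope complex_scope.
Local Open Scope ring_scope.

Section Branches.
Variable R : realType.

(* R[i]^o is the copy of R[i] that carries the normed-module structure, to which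
   the rules for limits of sums and products apply. *)
Local Notation cvgC F u z := ((u : _ -> R[i]^o) @ F --> (z : R[i]^o)).

(** * Limits of complex-valued functions along filters *)

Lemma cvg_real_complex (T : Type) (F : set_system T) {FF : Filter F}
    (u : T -> R) (x : R) :
  u @ F --> x -> cvgC F (fun t => (u t)%:C) x%:C.
Proof.
move=> /cvgrPdist_lt ux; apply/cvgrPdist_lt => e e0.
have eE : e = (complex.Re e)%:C.
  by rewrite RRe_real // ger0_real // ltW.
have e0' : 0 < complex.Re e by move: e0; rewrite ltcE => /andP[].
apply: filterS (ux _ e0') => t xt; rewrite -rmorphB normc_def /=.
rewrite expr0n /= addr0 sqrtr_sqr.
by rewrite eE ltcR.
Qed.

Lemma ultra_fmap (T U : Type) (f : T -> U) (F : set_system T) :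
  UltraFilter F -> UltraFilter (nbhs (f @ F)).
Proof.
move=> FU; split; first exact: fmap_proper_filter.
move=> G GF sFG; apply/seteqP; split=> A; last exact: sFG.
have [//|FnA GA] := in_ultra_setVsetC (f @^-1` A) FU.
by have /filter_ex[x []] : G (A `&` ~` A) by apply: filterI => //; exact: sFG.
Qed.

(** Compactness of discs: the real and imaginary parts stay in a segment, so
    they converge along an ultrafilter. *)
Lemma bounded_ultra_cvg (T : Type) (F : set_system T) {FF : UltraFilter F}
    (u : T -> R[i]) (C : R[i]) :
  (\forall t \near F, `|u t| <= C) -> exists z : R[i], cvgC F u z.
Proof.
move=> uC.
have H (h : R[i] -> R) :
  (forall z, `|h z| <= complex.Re `|z|) -> exists x : R, h \o u @ F --> x.
  move=> hz.
  move: (@segment_compact R (- complex.Re C) (complex.Re C)).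
  rewrite compact_ultra.
  move=> /(_ (nbhs (h \o u @ F)) (ultra_fmap _ FF))[|x [_ hx]]; last by exists x.
  apply: filterS uC => t /=; rewrite in_itv /= -ler_norml => le.
  by apply: le_trans (hz _) _; move: le; rewrite lecE /= => /andP[].
have [x ux] : exists x : R, (fun t => complex.Re (u t)) @ F --> x.
  apply: H => z; rewrite normc_def /= -sqrtr_sqr; apply: ler_wsqrtr.
  by rewrite lerDl sqr_ge0.
have [y uy] : exists x : R, (fun t => complex.Im (u t)) @ F --> x.
  apply: H => z; rewrite normc_def /= -sqrtr_sqr; apply: ler_wsqrtr.
  by rewrite lerDr sqr_ge0.
exists (x%:C + 'i * y%:C).
rewrite (_ : u = fun t => (complex.Re (u t))%:C + 'i * (complex.Im (u t))%:C);
  last first.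
  by apply/funext => t; case: (u t) => a b; simpc.
apply: cvgD; first exact: cvg_real_complex.
apply: cvgM; first exact: cvg_cst.
exact: cvg_real_complex.
Qed.

Lemma near_Re_gt0 (T : Type) (F : set_system T) {FF : Filter F}
    (u : T -> R[i]) (z : R[i]) :
  cvgC F u z -> 0 < z ->
  \forall t \near F, 0 < complex.Re (u t).
Proof.
move=> /cvgrPdist_lt uz z0; apply: filterS (uz _ z0) => t.
rewrite ltcE => /andP[_ zu].
have : `|complex.Re (z - u t)| < complex.Re z.
  apply: le_lt_trans zu; have := normc_ge_Re (z - u t).
  by rewrite lecE => /andP[].
rewrite raddfB /= => /(le_lt_trans (ler_norm _)).
by rewrite ltrBlDr ltrDl.
Qed.

Lemma cvg_conj (T : Type) (F : set_system T) {FF : Filter F}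
    (u : T -> R[i]) (z : R[i]) :
  cvgC F u z ->
  cvgC F (fun t => (u t)^*) (z^*).
Proof.
move=> /cvgrPdist_lt uz; apply/cvgrPdist_lt => e /uz.
by apply: filterS => t; rewrite -rmorphB norm_conjC.
Qed.

(** Every closed condition on eigenvectors passes to the limit in this form,
    being written as the vanishing of a continuous expression. *)
Lemma cvg_eq0 (T : Type) (F : set_system T) {FF : ProperFilter F} (u : T -> R[i])
    (z : R[i]) :
  cvgC F u z -> (\forall t \near F, u t = 0) -> z = 0.
Proof.
move=> uz u0; apply: (@cvg_unique _ (@norm_hausdorff R[i] R[i]^o) (u @ F)) => //.
apply: (cvg_trans (near_eq_cvg _)) (cvg_cst (0 : R[i]^o)).
by apply: filterS u0 => t ->.
Qed.

Lemma cvg_sum (K : numFieldType) (V : normedModType K) (T : Type)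
    (F : set_system T) {FF : Filter F} (I : Type) (r : seq I) (P : pred I)
    (u : I -> T -> V) (z : I -> V) :
  (forall j, P j -> u j @ F --> z j) ->
  (fun t => \sum_(j <- r | P j) u j t) @ F --> \sum_(j <- r | P j) z j.
Proof.
move=> uz; apply: cvg_big => //; exact: add_continuous.
Qed.

Lemma cvg_sum_complex (T : Type) (F : set_system T) {FF : Filter F}
    (I : Type) (r : seq I) (P : pred I) (u : I -> T -> R[i]) (z : I -> R[i]) :
  (forall j, P j -> cvgC F (u j) (z j)) ->
  cvgC F (fun t => \sum_(j <- r | P j) u j t) (\sum_(j <- r | P j) z j).
Proof. exact: (@cvg_sum R[i] R[i]^o). Qed.

(** * Green's identity and the weighted inner product *)

(** Indexed by nat rather than by 'I_4, so that the conditions [A | B] and the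
    boundary form can be written with literal indices. *)
Definition boundary_values N f (y : 'rV[R[i]]_N.+2) (k : nat) : R[i] :=
  [:: term y 0; (f 0%N)%:C * fwd_diff (term y) 0;
      term y N; (f N)%:C * fwd_diff (term y) N]`_k.

(** The difference between n = N and n = 0 of the Casoratian (discrete
    Wronskian) y_n conj(f_n Dv_n) - f_n Dy_n conj(v_n), written in terms of the
    boundary values b of y and c of v. *)
Definition lagrange_form (b c : nat -> R[i]) : R[i] :=
  b 2%N * (c 3%N)^* - b 3%N * (c 2%N)^* - (b 0%N * (c 1%N)^* - b 1%N * (c 0%N)^*).

Definition weighted_dot N (w : nat -> R) (y v : 'rV[R[i]]_N.+2) : R[i] :=
  \sum_(0 <= n < N) (w n.+1)%:C * term y n.+1 * (term v n.+1)^*.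

Lemma satisfies_bcP N f (M : 'M[R[i]]_(2, 2 + 2)) (y : 'rV[R[i]]_N.+2) :
  satisfies_bc f M y <-> forall i, \sum_(j < 4) M i j * boundary_values f y j = 0.
Proof.
rewrite /satisfies_bc.
suff H i : (lsubmx M *m boundary_vector f y 0 +
            rsubmx M *m boundary_vector f y N) i 0 =
           \sum_(j < 4) M i j * boundary_values f y j.
  split=> [E i|E]; first by rewrite -H E mxE.
  by apply/matrixP => i j; rewrite ord1 H E mxE.
rewrite !(mxE, big_ord_recl, big_ord0) /= !addr0 -!addrA /boundary_values /=.
by congr (_ * _ + (_ * _ + (_ * _ + _ * _))); congr (M _ _); apply/val_inj.
Qed.

(** In the equation for y times conj(v), minus y times the conjugated equation
    for v, the terms with q cancel and the others are the increments of the
    Casoratian, since f, q and w are real. *)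
Lemma green_identity N f q w (lam mu : R) (y v : 'rV[R[i]]_N.+2) :
  solves_equation f q w lam%:C y -> solves_equation f q w mu%:C v ->
  (lam - mu)%:C * weighted_dot w y v =
    lagrange_form (boundary_values f y) (boundary_values f v).
Proof.
move=> Ey Ev.
pose W n := term y n * ((f n)%:C * fwd_diff (term v) n)^*
   - (f n)%:C * fwd_diff (term y) n * (term v n)^*.
have -> : lagrange_form (boundary_values f y) (boundary_values f v) =
  W N - W 0%N by [].
rewrite -telescope_sumr // mulr_sumr; apply: eq_big_nat => n /andP[_ nN].
have := Ey n.+1 nN; have /(congr1 Num.conj) := Ev n.+1 nN.
rewrite /W /fwd_diff /bwd_diff /= !(rmorphM, rmorphB, rmorphD, rmorphN) /=.
rewrite !conj_real_complex.
move=> Ev' Ey'.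
set t0 := term y n.+1 in Ey' *; set s0 := (term v n.+1)^* in Ev' *.
have -> : (lam%:C - mu%:C) * ((w n.+1)%:C * t0 * s0) =
          lam%:C * (w n.+1)%:C * t0 * s0 - t0 * (mu%:C * (w n.+1)%:C * s0).
  by ring.
rewrite -Ev' -Ey'; ring.
Qed.

(** The equations at n = 1 and n = N recover y_0 and y_{N+1} from the interior
    terms; N >= 2 ensures that each of them contains a single end term. *)
Lemma solution_interior_eq0 N (f q w : nat -> R) lam (y : 'rV[R[i]]_N.+2) :
  (2 <= N)%N -> (forall n, (n <= N)%N -> f n != 0) ->
  solves_equation f q w lam y ->
  (forall n, (1 <= n <= N)%N -> term y n = 0) -> y = 0.
Proof.
move=> N2 f0 Ey y0.
have y00 : term y 0 = 0.
  have := Ey 1%N (ltnW N2); rewrite /bwd_diff /fwd_diff /=.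
  rewrite (y0 1%N) ?(y0 2%N) ?N2 ?(ltnW N2) //.
  rewrite !(subr0, sub0r, mulr0, addr0, mulrN, opprK, oppr0) => /eqP.
  rewrite oppr_eq0 mulf_eq0 => /orP[/eqP/(@complexI R) E|/eqP//].
  by move: (f0 0%N isT); rewrite E eqxx.
have yN0 : term y N.+1 = 0.
  have N1 : (1 <= N)%N by exact: ltnW.
  have := Ey N; rewrite N1 leqnn => /(_ isT); rewrite /bwd_diff /fwd_diff /=.
  have N1p : (1 <= N.-1 <= N)%N by rewrite leq_pred andbT -ltnS prednK.
  rewrite prednK // (y0 N) ?N1 ?leqnn // (y0 N.-1) //.
  rewrite !(subr0, sub0r, mulr0, addr0, mulrN, opprK, oppr0) => /eqP.
  rewrite oppr_eq0 mulf_eq0 => /orP[/eqP/(@complexI R) E|/eqP//].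
  by move: (f0 N (leqnn _)); rewrite E eqxx.
apply/rowP => j; rewrite mxE.
suff : term y j = 0 by rewrite /term inord_val.
have := ltn_ord j; case: (posnP j) => [-> //|j1].
rewrite ltnS leq_eqVlt => /orP[/eqP-> //|]; rewrite ltnS => jN.
by apply: y0; rewrite j1.
Qed.

(** The weighted form ignores y_0 and y_{N+1}, hence is only semidefinite on
    sequences; it is definite on solutions because those are determined by
    their interior terms. *)
Lemma weighted_dot_gt0 N (f q w : nat -> R) lam (y : 'rV[R[i]]_N.+2) :
  (2 <= N)%N -> Omega_Rplus N f w ->
  solves_equation f q w lam y -> y != 0 -> 0 < weighted_dot w y y.
Proof.
move=> N2 [f0 w0] Ey yN0.
have ge0 (n : 'I_N) : 0 <= (w n.+1)%:C * term y n.+1 * (term y n.+1)^*.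
  by rewrite -mulrA mulr_ge0 ?mul_conjC_ge0 // ler0c ltW // w0 //= ltn_ord.
rewrite /weighted_dot big_mkord lt_def sumr_ge0 // andbT psumr_eq0 //.
apply: contra yN0 => /allP all0; apply/eqP.
apply: (solution_interior_eq0 N2 f0 Ey) => -[|n] //= nN.
have /eqP := all0 (Ordinal nN) (mem_index_enum _).
rewrite -mulrA => /eqP; rewrite mulf_eq0 mul_conjC_eq0 => /orP[|/eqP//].
by move=> /eqP/(@complexI R) E; move: (w0 n.+1 nN); rewrite E ltxx.
Qed.

(** * Limits of normalised eigenvectors *)

(** The l^1 norm is used because its value 1 bounds every entry, requires no
    square root, and is preserved by entrywise limits. *)
Lemma exists_normalized n (y : 'rV[R[i]]_n) : y != 0 ->
  exists2 c : R[i], c != 0 & \sum_i `|(c *: y) 0 i| = 1.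
Proof.
move=> y0; pose S := \sum_i `|y 0 i|.
have S0 : S != 0.
  rewrite psumr_eq0 //; apply: contra y0 => /allP all0; apply/eqP/rowP => i.
  by apply/eqP; rewrite mxE -normr_eq0; exact: all0 (mem_index_enum _).
have Sge0 : 0 <= S by apply: sumr_ge0.
exists S^-1; first by rewrite invr_eq0.
under eq_bigr => i _ do rewrite mxE normrM normfV (ger0_norm Sge0).
by rewrite -mulr_sumr mulVf.
Qed.

Lemma termZ N c (y : 'rV[R[i]]_N.+2) n : term (c *: y) n = c * term y n.
Proof. by rewrite /term mxE. Qed.

Lemma solves_equationZ N (f q w : nat -> R) lam c (y : 'rV[R[i]]_N.+2) :
  solves_equation f q w lam y -> solves_equation f q w lam (c *: y).
Proof.
move=> Ey n /Ey; rewrite /bwd_diff /fwd_diff !termZ => E.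
by rewrite [RHS]mulrCA -E; ring.
Qed.

Lemma satisfies_bcZ N (f : nat -> R) M c (y : 'rV[R[i]]_N.+2) :
  satisfies_bc f M y -> satisfies_bc f M (c *: y).
Proof.
rewrite /satisfies_bc.
have H k : boundary_vector f (c *: y) k = c *: boundary_vector f y k.
  apply/matrixP => i j; rewrite !mxE /fwd_diff !termZ; case: ifP => _ //; ring.
by rewrite !H -!scalemxAr -scalerDr => ->; rewrite scaler0.
Qed.

(** Compactness of the unit sphere, entry by entry; the limit is nonzero since
    its norm is 1. *)
Lemma normalized_ultra_limit (T : Type) (U : set_system T) {UU : UltraFilter U}
    n (v : T -> 'rV[R[i]]_n) :
  (\forall t \near U, \sum_i `|v t 0 i| = 1) ->
  exists2 y : 'rV[R[i]]_n, y != 0 &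
    forall i, cvgC U (fun t => v t 0 i) (y 0 i).
Proof.
move=> v1.
have lim i : exists z : R[i], cvgC U (fun t => v t 0 i) z.
  apply: (bounded_ultra_cvg (C := 1)).
  apply: filterS v1 => t <-; rewrite (bigD1 i) //= lerDl.
  by apply: sumr_ge0.
pose y := \row_i sval (cid (lim i)).
have vy i : cvgC U (fun t => v t 0 i) (y 0 i).
  by rewrite mxE; exact: svalP (cid (lim i)).
exists y => //; apply/eqP => y0.
have : \sum_i `|y 0 i| - 1 = 0.
  apply: (@cvg_eq0 _ U _ (fun t => \sum_i `|v t 0 i| - 1)); last first.
    by apply: filterS v1 => t ->; rewrite subrr.
  apply: cvgB; last exact: cvg_cst.
  by apply: cvg_sum_complex => i _; apply: (@cvg_norm R[i] R[i]^o); exact: vy.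
rewrite y0 big1 => [/eqP|i _]; last by rewrite mxE normr0.
by rewrite sub0r oppr_eq0 oner_eq0.
Qed.

(** The equation and the boundary condition are polynomial in the data
    lam, M and v, hence closed. *)
Lemma eigen_limit (T : Type) (U : set_system T) {UU : ProperFilter U} N
    (f q w : nat -> R) (lam : T -> R) (M : T -> 'M[R[i]]_(2, 2 + 2))
    (v : T -> 'rV[R[i]]_N.+2) (lam0 : R) (M0 : 'M[R[i]]_(2, 2 + 2))
    (y : 'rV[R[i]]_N.+2) :
  lam @ U --> lam0 ->
  (forall i j, cvgC U (fun t => M t i j) (M0 i j)) ->
  (forall i, cvgC U (fun t => v t 0 i) (y 0 i)) ->
  (\forall t \near U, solves_equation f q w (lam t)%:C (v t) /\
     satisfies_bc f (M t) (v t)) ->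
  [/\ solves_equation f q w lam0%:C y, satisfies_bc f M0 y &
      forall k, cvgC U (fun t => boundary_values f (v t) k)
        (boundary_values f y k)].
Proof.
move=> lamc Mc vc E.
have tc n : cvgC U (fun t => term (v t) n) (term y n).
  exact: vc.
have fc n : cvgC U (fun t => (f n)%:C * fwd_diff (term (v t)) n)
    ((f n)%:C * fwd_diff (term y) n).
  by apply: cvgM; [exact: cvg_cst|exact: cvgB].
have bc k : cvgC U (fun t => boundary_values f (v t) k) (boundary_values f y k).
  case: k => [|[|[|[|k]]]]; rewrite /boundary_values /=;
    [exact: tc|exact: fc|exact: tc|exact: fc|].
  exact: cvg_cst.
split=> // [n nN|].
- apply/eqP; rewrite -subr_eq0; apply/eqP.
  apply: (@cvg_eq0 _ U _ (fun t =>
    - bwd_diff (fun k => (f k)%:C * fwd_diff (term (v t)) k) n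
    + (q n)%:C * term (v t) n - (lam t)%:C * (w n)%:C * term (v t) n));
    last first.
    by apply: filterS E => t [+ _] => /(_ n nN) ->; rewrite subrr.
  apply: cvgB.
    apply: cvgD; last by apply: cvgM; [exact: cvg_cst|exact: tc].
    by apply: cvgN; apply: cvgB; exact: fc.
  apply: cvgM; last exact: tc.
  by apply: cvgM; [exact: cvg_real_complex|exact: cvg_cst].
- apply/satisfies_bcP => i.
  apply: (@cvg_eq0 _ U _ (fun t =>
    \sum_(j < 4) M t i j * boundary_values f (v t) j)).
    by apply: cvg_sum_complex => j _; apply: cvgM; [exact: Mc|exact: bc].
  by apply: filterS E => t [_ /satisfies_bcP].
Qed.

(** * Monotonicity of eigenvalues along a rank-one direction *)

(** With c the supremum of the u in [s, t] such that g s <= g u, the hypothesis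
    at c, used to the left, shows that c itself has this property, and used to
    the right it contradicts c < t. *)
Lemma locally_monotone_le (g : R -> R) (s t : R) : s <= t ->
  (forall a, s <= a <= t -> \forall u \near a, 0 <= (g u - g a) * (u - a)) ->
  g s <= g t.
Proof.
move=> st loc.
pose S := [set u | s <= u <= t /\ g s <= g u].
have Ss : S s by split; rewrite ?lexx.
have Sub : has_ubound S by exists t => u [/andP[]].
have Ssup : has_sup S by split; [exists s|].
pose c := sup S.
have sc : s <= c by exact: ub_le_sup.
have ct : c <= t by apply: ge_sup; [exists s|move=> u [/andP[]]].
have /nbhs_ballP[d /= d0 cd] := loc c (introT andP (conj sc ct)).
have gc : g s <= g c.
  have [u [ust gu] cu] := sup_adherent d0 Ssup.
  have uc : u <= c by apply: ub_le_sup.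
  move: uc; rewrite le_eqVlt => /orP[/eqP <-//|uc].
  have := cd u; rewrite /ball /= ger0_norm ?subr_ge0 ?(ltW uc) //.
  rewrite ltrBlDr -ltrBlDl => /(_ cu); rewrite nmulr_lge0 ?subr_lt0 // subr_le0.
  exact: le_trans.
move: ct; rewrite le_eqVlt => /orP[/eqP <-//|ct].
pose u := Num.min t (c + d / 2).
have cu : c < u by rewrite lt_min ct ltrDl divr_gt0.
have ut : u <= t by rewrite ge_min lexx.
have : 0 <= (g u - g c) * (u - c).
  apply: cd; rewrite /ball /= distrC ger0_norm ?subr_ge0 ?(ltW cu) //.
  rewrite ltrBlDl gt_min ltrD2l ltr_pdivrMr // ltr_pMr // ltr1n orbT //.
rewrite pmulr_lge0 ?subr_gt0 // subr_ge0 => gcu.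
have : u <= c.
  apply: ub_le_sup => //; split; last exact: le_trans gcu.
  by rewrite ut (le_trans sc (ltW cu)).
by rewrite leNgt cu.
Qed.

(** The boundary form between the conditions M a and M a' is (a - a') times the
    rank-one positive form of the k-th boundary value: what the Green identity
    needs to give the eigenvalues a sign of variation along a |-> M a. *)
Definition rank_one_direction (M : R -> 'M[R[i]]_(2, 2 + 2)) (k : nat) : Prop :=
  forall (a a' : R) (b c : nat -> R[i]),
    (forall i, \sum_(j < 4) M a i j * b j = 0) ->
    (forall i, \sum_(j < 4) M a' i j * c j = 0) ->
    lagrange_form b c = (a - a')%:C * (b k * (c k)^*).

(** If the inequality failed for u arbitrarily close to a, an ultrafilter on such
    u would produce a limit eigenvector y at a, and the Green identity between y
    and the eigenvectors at u would equate numbers of opposite signs. *)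
Lemma local_monotone N (f q w : nat -> R) (M : R -> 'M[R[i]]_(2, 2 + 2)) k
    (lam : R -> R) (a : R) :
  (2 <= N)%N -> Omega_Rplus N f w -> rank_one_direction M k ->
  (forall i j, cvgC a (fun u => M u i j) (M a i j)) ->
  lam @ a --> lam a ->
  (\forall u \near a, exists2 y : 'rV[R[i]]_N.+2, y != 0 &
     solves_equation f q w (lam u)%:C y /\ satisfies_bc f (M u) y) ->
  \forall u \near a, 0 <= (lam u - lam a) * (u - a).
Proof.
move=> N2 Om rk1 Mc lamc E; apply: contrapT => nP.
pose bad := [set u : R | ~ 0 <= (lam u - lam a) * (u - a)].
(* Were this filter improper, there would be no bad point near a, which is the
   conclusion. *)
have badP : ProperFilter (within bad (nbhs a)).
  apply: Build_ProperFilter => badN; apply: nP.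
  by apply: (@filterS _ (nbhs a) _ _ _ _ badN) => u Pu; apply: contrapT => /Pu.
have [U [UU bU]] := ultraFilterLemma badP.
have aU : nbhs a `<=` U by move=> A aA; apply: bU; apply: filterS aA.
have Ubad : U bad by apply: bU; exact: withinT.
pose good (u : R) (v : 'rV[R[i]]_N.+2) :=
  [/\ \sum_i `|v 0 i| = 1, solves_equation f q w (lam u)%:C v
    & satisfies_bc f (M u) v].
pose v (u : R) := xget (0 : 'rV[R[i]]_N.+2) (good u).
have Uv : \forall u \near U, good u (v u).
  apply: aU; apply: filterS E => u [y y0 [Ey By]]; apply: xgetPex.
  have [c c0 cy] := exists_normalized y0.
  by exists (c *: y); split; [|exact: solves_equationZ|exact: satisfies_bcZ].
have [y y0 vy] : exists2 y : 'rV[R[i]]_N.+2, y != 0 &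
    forall i, cvgC U (fun t => v t 0 i) (y 0 i).
  by apply: normalized_ultra_limit; apply: filterS Uv => u [].
have lamU : lam @ U --> lam a by move=> A /lamc /aU.
have MU i j : cvgC U (fun u => M u i j) (M a i j).
  by move=> A /Mc /aU.
have [Ey By bc] : [/\ solves_equation f q w (lam a)%:C y, satisfies_bc f (M a) y &
      forall k, cvgC U (fun t => boundary_values f (v t) k)
        (boundary_values f y k)].
  by apply: (eigen_limit lamU MU vy); apply: filterS Uv => u [].
have Hc : cvgC U (fun u => weighted_dot w y (v u)) (weighted_dot w y y).
  apply: cvg_sum_complex => n _; apply: cvgM; first exact: cvg_cst.
  by apply: cvg_conj; exact: vy.
have Kc : cvgC U
  (fun u => boundary_values f y k * (boundary_values f (v u) k)^*)
  (boundary_values f y k * (boundary_values f y k)^*).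
  by apply: cvgM; [exact: cvg_cst|apply: cvg_conj; exact: bc].
have H0 : \forall u \near U, 0 < complex.Re (weighted_dot w y (v u)).
  exact: near_Re_gt0 Hc (weighted_dot_gt0 N2 Om Ey y0).
(* If l(y) = 0 the product vanishes for every u, otherwise its limit |l(y)|^2
   is positive. *)
have K0 : \forall u \near U,
  0 <= complex.Re (boundary_values f y k * (boundary_values f (v u) k)^*).
  have [b0|b0] := eqVneq (boundary_values f y k) 0.
    by apply: filterE => u; rewrite b0 mul0r.
  have b1 : 0 < boundary_values f y k * (boundary_values f y k)^*.
    by rewrite mul_conjC_gt0.
  by apply: filterS (near_Re_gt0 Kc b1) => u /ltW.
have [u [[[badu [_ Eu Bu]] Hu] Ku]] : exists u, ((bad u /\ good u (v u)) /\
  0 < complex.Re (weighted_dot w y (v u))) /\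
  0 <= complex.Re (boundary_values f y k * (boundary_values f (v u) k)^*).
  apply: (@filter_ex _ U); apply: filterI => //; apply: filterI => //.
  exact: filterI.
have := green_identity Ey Eu.
rewrite (rk1 a u _ _ ((satisfies_bcP _ _ _).1 By) ((satisfies_bcP _ _ _).1 Bu)).
have ReM (x : R) (z : R[i]) : complex.Re (x%:C * z) = x * complex.Re z.
  by case: z => z1 z2; simpc.
move=> /(congr1 (@complex.Re R)); rewrite !ReM => eqRe.
apply: badu; rewrite leNgt; apply/negP => lt0.
have : (lam u - lam a) * (u - a) * complex.Re (weighted_dot w y (v u)) < 0.
  by rewrite nmulr_rlt0.
have -> : (lam u - lam a) * (u - a) * complex.Re (weighted_dot w y (v u)) =
  (u - a) ^+ 2 *
    complex.Re (boundary_values f y k * (boundary_values f (v u) k)^*).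
  transitivity (
    (a - u) * ((lam a - lam u) * complex.Re (weighted_dot w y (v u)))).
    by ring.
  by rewrite eqRe; ring.
by rewrite ltNge mulr_ge0 ?sqr_ge0.
Qed.

(** * Branches along paths of boundary conditions *)

Lemma mk_BC_continuous (M : R -> 'M[R[i]]_(2, 2 + 2))
    (rkM : forall u, rank2_mx (M u)) (saM : forall u, self_adjoint_mx (M u)) :
  (forall a i j, cvgC a (fun u => M u i j) (M a i j)) ->
  continuous (fun u => mk_BC (rkM u) (saM u)).
Proof.
move=> Mc.
apply: continuous_comp_initial.
have Mcont : continuous (fun u => SigSub (mem_set (rkM u)) : rank2_mx (R:=R)).
  apply: continuous_comp_initial => a A [P PM sPA].
  have : \forall u \near a, forall i j, P i j (M u i j).
    apply: (@filter_forall _ _ (fun i u => forall j, P i j (M u i j)) _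
      (nbhs_filter a)) => i.
    apply: (@filter_forall _ _ (fun j u => P i j (M u i j)) _
      (nbhs_filter a)) => j.
    by move: (PM i j); rewrite set_valE /= => /(Mc a i j).
  by apply: filterS => u Pu; apply: sPA => i j; rewrite /= set_valE; exact: Pu.
rewrite (_ : _ \o _ = (fun M => bc_class M) \o
  (fun u => SigSub (mem_set (rkM u)) : rank2_mx (R:=R))); last first.
  by apply/funext => u; rewrite /= set_valE.
move=> a; apply: continuous_comp; first exact: Mcont.
exact: pi_continuous.
Qed.

Lemma mx_of_rows_continuous (r1 r2 : R -> seq R[i]) (a : R) :
  (forall n, cvgC a (fun u => (r1 u)`_n) ((r1 a)`_n)) ->
  (forall n, cvgC a (fun u => (r2 u)`_n) ((r2 a)`_n)) ->
  forall i j, cvgC a (fun u => mx_of_rows (r1 u) (r2 u) i j)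
    (mx_of_rows (r1 a) (r2 a) i j).
Proof.
move=> c1 c2 i j; rewrite mxE; under eq_fun => u do rewrite mxE.
by case: ifP => _; [exact: c1|exact: c2].
Qed.

Lemma cvg_real_complex_id (a : R) : cvgC a (fun u => u%:C) a%:C.
Proof. exact: cvg_real_complex cvg_id. Qed.

(** The parameters whose boundary condition lies in D form an open set, because
    D is open and the path continuous; so around each point of the segment the
    branch provides the nearby eigenpairs that local_monotone compares. *)
Lemma branch_increasing_along N (f q w : nat -> R) (D : set (BC R))
    (L : BC R -> R) (M : R -> 'M[R[i]]_(2, 2 + 2)) k
    (rkM : forall u, rank2_mx (M u)) (saM : forall u, self_adjoint_mx (M u)) :
  (2 <= N)%N -> Omega_Rplus N f w -> continuous_eigenvalue_branch N f q w D L ->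
  rank_one_direction M k ->
  (forall a i j, cvgC a (fun u => M u i j) (M a i j)) ->
  increasing_along D L (fun u => mk_BC (rkM u) (saM u)).
Proof.
move=> N2 Om [[oD _] Lc Le _ _] rk1 Mc s t st Dp.
have pc := mk_BC_continuous (rkM := rkM) (saM := saM) Mc.
apply: (locally_monotone_le (g := fun u => L (mk_BC (rkM u) (saM u)))) => //.
move=> a /Dp Da.
apply: (local_monotone (q := q) N2 Om rk1 (Mc a)).
  apply: cvg_comp; first exact: pc.
  by move: Lc; rewrite continuous_open_subspace // => /(_ _ (mem_set Da)).
have : \forall u \near a, D (mk_BC (rkM u) (saM u)).
  by apply: pc; exact: open_nbhs_nbhs.
apply: filterS => u /Le[y y0 [Ey By]]; exists y => //; split=> //.
have [T Tu E] := bc_mx_mk_BC (rkM u) (saM u).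
by apply/(satisfies_bcM _ _ _ Tu); rewrite -E.
Qed.

(** * The real coordinate directions of the four charts *)

Lemma mx_of_rows_mul_eq0 (r1 r2 : seq R[i]) (b : nat -> R[i]) :
  (forall i, \sum_(j < 4) mx_of_rows r1 r2 i j * b j = 0) ->
  r1`_0 * b 0%N + r1`_1 * b 1%N + r1`_2 * b 2%N + r1`_3 * b 3%N = 0 /\
  r2`_0 * b 0%N + r2`_1 * b 1%N + r2`_2 * b 2%N + r2`_3 * b 3%N = 0.
Proof.
move=> E; have := E ord0; have := E ord_max.
by rewrite !(mxE, big_ord_recl, big_ord0) /= !addr0 !addrA.
Qed.

(** In each chart the condition expresses two boundary values through the other
    two. After substitution in the boundary form the terms with z and conj(z)
    cancel, by self-adjointness, and the real parameters survive only through
    their differences. *)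
Lemma lagrange_form_mx13 (a a' b b' : R) (z : R[i]) (u v : nat -> R[i]) :
  (forall i, \sum_(j < 4) mx13 a b z i j * u j = 0) ->
  (forall i, \sum_(j < 4) mx13 a' b' z i j * v j = 0) ->
  lagrange_form u v =
    (a - a')%:C * (u 1%N * (v 1%N)^*) + (b - b')%:C * (u 3%N * (v 3%N)^*).
Proof.
move=> /mx_of_rows_mul_eq0/=[E1 E2] /mx_of_rows_mul_eq0/=[F1 F2].
have U0 : u 0%N = - (a%:C * u 1%N + z^* * u 3%N) by rewrite -[LHS]subr0 -E1; ring.
have U2 : u 2%N = z * u 1%N + b%:C * u 3%N by rewrite -[LHS]addr0 -E2; ring.
have V0 : v 0%N = - (a'%:C * v 1%N + z^* * v 3%N) by rewrite -[LHS]subr0 -F1; ring.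
have V2 : v 2%N = z * v 1%N + b'%:C * v 3%N by rewrite -[LHS]addr0 -F2; ring.
rewrite /lagrange_form U0 U2 V0 V2 !(rmorphD, rmorphB, rmorphN, rmorphM) /=.
rewrite !conj_real_complex conjCK.
ring.
Qed.

Lemma lagrange_form_mx14 (a a' b b' : R) (z : R[i]) (u v : nat -> R[i]) :
  (forall i, \sum_(j < 4) mx14 a b z i j * u j = 0) ->
  (forall i, \sum_(j < 4) mx14 a' b' z i j * v j = 0) ->
  lagrange_form u v =
    (a - a')%:C * (u 1%N * (v 1%N)^*) + (b - b')%:C * (u 2%N * (v 2%N)^*).
Proof.
move=> /mx_of_rows_mul_eq0/=[E1 E2] /mx_of_rows_mul_eq0/=[F1 F2].
have U0 : u 0%N = - (a%:C * u 1%N + z^* * u 2%N) by rewrite -[LHS]subr0 -E1; ring.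
have U3 : u 3%N = - (z * u 1%N + b%:C * u 2%N) by rewrite -[LHS]subr0 -E2; ring.
have V0 : v 0%N = - (a'%:C * v 1%N + z^* * v 2%N) by rewrite -[LHS]subr0 -F1; ring.
have V3 : v 3%N = - (z * v 1%N + b'%:C * v 2%N) by rewrite -[LHS]subr0 -F2; ring.
rewrite /lagrange_form U0 U3 V0 V3 !(rmorphD, rmorphB, rmorphN, rmorphM) /=.
rewrite !conj_real_complex conjCK.
ring.
Qed.

Lemma lagrange_form_mx23 (a a' b b' : R) (z : R[i]) (u v : nat -> R[i]) :
  (forall i, \sum_(j < 4) mx23 a b z i j * u j = 0) ->
  (forall i, \sum_(j < 4) mx23 a' b' z i j * v j = 0) ->
  lagrange_form u v =
    (a - a')%:C * (u 0%N * (v 0%N)^*) + (b - b')%:C * (u 3%N * (v 3%N)^*).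
Proof.
move=> /mx_of_rows_mul_eq0/=[E1 E2] /mx_of_rows_mul_eq0/=[F1 F2].
have U1 : u 1%N = a%:C * u 0%N + z^* * u 3%N by rewrite -[LHS]addr0 -E1; ring.
have U2 : u 2%N = z * u 0%N + b%:C * u 3%N by rewrite -[LHS]addr0 -E2; ring.
have V1 : v 1%N = a'%:C * v 0%N + z^* * v 3%N by rewrite -[LHS]addr0 -F1; ring.
have V2 : v 2%N = z * v 0%N + b'%:C * v 3%N by rewrite -[LHS]addr0 -F2; ring.
rewrite /lagrange_form U1 U2 V1 V2 !(rmorphD, rmorphB, rmorphN, rmorphM) /=.
rewrite !conj_real_complex conjCK.
ring.
Qed.

Lemma lagrange_form_mx24 (a a' b b' : R) (z : R[i]) (u v : nat -> R[i]) :
  (forall i, \sum_(j < 4) mx24 a b z i j * u j = 0) ->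
  (forall i, \sum_(j < 4) mx24 a' b' z i j * v j = 0) ->
  lagrange_form u v =
    (a - a')%:C * (u 0%N * (v 0%N)^*) + (b - b')%:C * (u 2%N * (v 2%N)^*).
Proof.
move=> /mx_of_rows_mul_eq0/=[E1 E2] /mx_of_rows_mul_eq0/=[F1 F2].
have U1 : u 1%N = a%:C * u 0%N + z^* * u 2%N by rewrite -[LHS]addr0 -E1; ring.
have U3 : u 3%N = - (z * u 0%N + b%:C * u 2%N) by rewrite -[LHS]subr0 -E2; ring.
have V1 : v 1%N = a'%:C * v 0%N + z^* * v 2%N by rewrite -[LHS]addr0 -F1; ring.
have V3 : v 3%N = - (z * v 0%N + b'%:C * v 2%N) by rewrite -[LHS]subr0 -F2; ring.
rewrite /lagrange_form U1 U3 V1 V3 !(rmorphD, rmorphB, rmorphN, rmorphM) /=.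
rewrite !conj_real_complex conjCK.
ring.
Qed.

End Branches.

Theorem theorem4p6 (R : realType) (N : nat) (f q w : nat -> R) :
  (2 <= N)%N -> Omega_Rplus N f w ->
  forall (D : set (BC R)) (L : BC R -> R),
    continuous_eigenvalue_branch N f q w D L ->
    [/\ (forall b22 z, increasing_along D L (fun a12 => O13 a12 b22 z)) /\
        (forall a12 z, increasing_along D L (fun b22 => O13 a12 b22 z)),
        (forall b21 z, increasing_along D L (fun a12 => O14 a12 b21 z)) /\
        (forall a12 z, increasing_along D L (fun b21 => O14 a12 b21 z)),
        (forall b22 z, increasing_along D L (fun a11 => O23 a11 b22 z)) /\
        (forall a11 z, increasing_along D L (fun b22 => O23 a11 b22 z)) &
        (forall b21 z, increasing_along D L (fun a11 => O24 a11 b21 z)) /\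
        (forall a11 z, increasing_along D L (fun b21 => O24 a11 b21 z))].
Proof.
move=> N2 Om D L LD.
split; split=> x z.
- apply: (branch_increasing_along (k := 1)
    (rkM := fun u => mx13_rank2 u x z) (saM := fun u => mx13_self_adjoint u x z)
    N2 Om LD) => [a a' u v Hu Hv|a].
    by rewrite (lagrange_form_mx13 Hu Hv) subrr mul0r addr0.
  by apply: mx_of_rows_continuous => -[|[|[|[|n]]]] /=;
    first [exact: cvg_cst | exact: cvg_real_complex_id].
- apply: (branch_increasing_along (k := 3)
    (rkM := fun u => mx13_rank2 x u z) (saM := fun u => mx13_self_adjoint x u z)
    N2 Om LD) => [a a' u v Hu Hv|a].
    by rewrite (lagrange_form_mx13 Hu Hv) subrr mul0r add0r.
  by apply: mx_of_rows_continuous => -[|[|[|[|n]]]] /=;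
    first [exact: cvg_cst | exact: cvg_real_complex_id].
- apply: (branch_increasing_along (k := 1)
    (rkM := fun u => mx14_rank2 u x z) (saM := fun u => mx14_self_adjoint u x z)
    N2 Om LD) => [a a' u v Hu Hv|a].
    by rewrite (lagrange_form_mx14 Hu Hv) subrr mul0r addr0.
  by apply: mx_of_rows_continuous => -[|[|[|[|n]]]] /=;
    first [exact: cvg_cst | exact: cvg_real_complex_id].
- apply: (branch_increasing_along (k := 2)
    (rkM := fun u => mx14_rank2 x u z) (saM := fun u => mx14_self_adjoint x u z)
    N2 Om LD) => [a a' u v Hu Hv|a].
    by rewrite (lagrange_form_mx14 Hu Hv) subrr mul0r add0r.
  by apply: mx_of_rows_continuous => -[|[|[|[|n]]]] /=;
    first [exact: cvg_cst | exact: cvg_real_complex_id].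
- apply: (branch_increasing_along (k := 0)
    (rkM := fun u => mx23_rank2 u x z) (saM := fun u => mx23_self_adjoint u x z)
    N2 Om LD) => [a a' u v Hu Hv|a].
    by rewrite (lagrange_form_mx23 Hu Hv) subrr mul0r addr0.
  by apply: mx_of_rows_continuous => -[|[|[|[|n]]]] /=;
    first [exact: cvg_cst | exact: cvg_real_complex_id].
- apply: (branch_increasing_along (k := 3)
    (rkM := fun u => mx23_rank2 x u z) (saM := fun u => mx23_self_adjoint x u z)
    N2 Om LD) => [a a' u v Hu Hv|a].
    by rewrite (lagrange_form_mx23 Hu Hv) subrr mul0r add0r.
  by apply: mx_of_rows_continuous => -[|[|[|[|n]]]] /=;
    first [exact: cvg_cst | exact: cvg_real_complex_id].
- apply: (branch_increasing_along (k := 0)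
    (rkM := fun u => mx24_rank2 u x z) (saM := fun u => mx24_self_adjoint u x z)
    N2 Om LD) => [a a' u v Hu Hv|a].
    by rewrite (lagrange_form_mx24 Hu Hv) subrr mul0r addr0.
  by apply: mx_of_rows_continuous => -[|[|[|[|n]]]] /=;
    first [exact: cvg_cst | exact: cvg_real_complex_id].
- apply: (branch_increasing_along (k := 2)
    (rkM := fun u => mx24_rank2 x u z) (saM := fun u => mx24_self_adjoint x u z)
    N2 Om LD) => [a a' u v Hu Hv|a].
    by rewrite (lagrange_form_mx24 Hu Hv) subrr mul0r add0r.
  by apply: mx_of_rows_continuous => -[|[|[|[|n]]]] /=;
    first [exact: cvg_cst | exact: cvg_real_complex_id].
Qed.
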